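(* Let $x>0$ and $\mu,\nu,a\in\mathbb{R}$. (1) If $\mu+a>-1$, $\mu-a>-1$, and $\mu+\epsilon_1 a+\epsilon_2\nu+3>0$ for all choices of signs $\epsilon_1,\epsilon_2\in\{1,-1\}$, then $$\lambda_{\mu,\nu}(x)^2\le \lambda_{\mu+a,\nu}(x)\,\lambda_{\mu-a,\nu}(x).$$ (2) If $\mu>-1$ and $\mu+\epsilon_1 a+\epsilon_2\nu+3>0$ for all choices of signs $\epsilon_1,\epsilon_2\in\{1,-1\}$, then $$\lambda_{\mu,\nu}(x)^2\le \lambda_{\mu,\nu+a}(x)\,\lambda_{\mu,\nu-a}(x).$$
   Context: The normalized modified Lommel function is $$\lambda_{\mu,\nu}(x)=\sum_{n=0}^\infty\frac{x^{2n}}{\left(\frac{\mu-\nu+3}{2}\right)_n\left(\frac{\mu+\nu+3}{2}\right)_n4^n},$$ where $(b)_n=b(b+1)\cdots(b+n-1)$, $(b)_0=1$, is the Pochhammer symbol. *)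

(* Defs.v *)
From Stdlib Require Import Reals Lra Lia.
From Coquelicot Require Import Coquelicot.
Open Scope R_scope.

Fixpoint pochhammer (b : R) (n : nat) : R :=
  match n with
  | O => 1
  | S m => pochhammer b m * (b + INR m)
  end.

Definition lommel_term (mu nu x : R) (n : nat) : R :=
  x ^ (2 * n) /
  (pochhammer ((mu - nu + 3) / 2) n * pochhammer ((mu + nu + 3) / 2) n * 4 ^ n).

(** [Series] is total; [ex_series_lommel_term] shows that it is a genuine sum
    as soon as no Pochhammer symbol in a denominator vanishes. *)
Definition lommel (mu nu x : R) : R := Series (lommel_term mu nu x).

Lemma pochhammer_neq_0 (b : R) (n : nat) :
  (forall k : nat, b + INR k <> 0) -> pochhammer b n <> 0.
Proof.
  intros Hb; induction n as [|n IH]; simpl.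
  - lra.
  - now apply Rmult_integral_contrapositive_currified.
Qed.

Lemma ex_series_lommel_term (mu nu x : R) :
  (forall k : nat, (mu - nu + 3) / 2 + INR k <> 0) ->
  (forall k : nat, (mu + nu + 3) / 2 + INR k <> 0) ->
  ex_series (lommel_term mu nu x).
Proof.
  intros Hb Hc.
  destruct (Req_dec x 0) as [->|Hx].
  - apply (ex_series_incr_1 (lommel_term mu nu 0)).
    exists 0. apply is_series_ext with (fun _ : nat => 0).
    + intros n. assert (H : lommel_term mu nu 0 (S n) = 0).
      { unfold lommel_term, Rdiv. rewrite pow_i by lia. ring. }
      now rewrite H.
    + unfold is_series. apply filterlim_ext with (fun _ : nat => 0).
      * intros n. now rewrite sum_n_const, Rmult_0_r.
      * apply filterlim_const.
  - apply ex_series_Rabs, ex_series_DAlembert with 0; [lra| |].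
    + intros n. unfold lommel_term, Rdiv.
      apply Rmult_integral_contrapositive_currified; [now apply pow_nonzero|].
      apply Rinv_neq_0_compat.
      repeat apply Rmult_integral_contrapositive_currified;
        try (now apply pochhammer_neq_0); apply pow_nonzero; lra.
    + apply is_lim_seq_ext with
        (fun n => Rabs (x ^ 2 / 4 * (/ ((mu - nu + 3) / 2 + INR n) *
                                     / ((mu + nu + 3) / 2 + INR n)))).
      * intros n. f_equal. unfold lommel_term.
        replace (2 * S n)%nat with (2 * n + 2)%nat by lia.
        rewrite pow_add. cbn [pochhammer]. rewrite <- (tech_pow_Rmult 4 n).
        pose proof (pochhammer_neq_0 _ n Hb) as Pb.
        pose proof (pochhammer_neq_0 _ n Hc) as Pc.
        pose proof (Hb n) as Hbn. pose proof (Hc n) as Hcn.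
        set (p := pochhammer ((mu - nu + 3) / 2) n) in *.
        set (q := pochhammer ((mu + nu + 3) / 2) n) in *.
        set (b := (mu - nu + 3) / 2 + INR n) in *.
        set (c := (mu + nu + 3) / 2 + INR n) in *.
        pose proof (pow_nonzero x (2 * n) Hx) as Hxn.
        assert (H4 : 4 ^ n <> 0) by (apply pow_nonzero; lra).
        set (y := x ^ (2 * n)) in *. set (z := 4 ^ n) in *.
        field. repeat split; assumption.
      * assert (Hinv : forall b, is_lim_seq (fun n => / (b + INR n)) 0).
        { intros b. apply (is_lim_seq_inv _ p_infty); [|easy].
          apply (is_lim_seq_plus _ _ b p_infty);
            [apply is_lim_seq_const|apply is_lim_seq_INR|easy]. }
        apply (proj1 (is_lim_seq_abs_0 _)).
        replace (Finite 0) with (Rbar_mult (x ^ 2 / 4) 0)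
          by (simpl; f_equal; ring).
        apply is_lim_seq_scal_l.
        replace (Finite 0) with (Finite (0 * 0)) by (f_equal; ring).
        apply is_lim_seq_mult'; apply Hinv.
Qed.

(* Main.v *)
Require Import Defs.
From Stdlib Require Import Reals Lra.
From Coquelicot Require Import Coquelicot.
Open Scope R_scope.

(** Both inequalities say that [lommel] is midpoint log-convex along a segment
    in the [(mu, nu)] plane, horizontal in the first case and vertical in the
    second.  It is in fact jointly midpoint log-convex on the whole cone
    [Rabs nu < mu + 3] ([lommel_midpoint_log_convex]), on which the two
    Pochhammer arguments are positive.

    The reason is termwise.  On the positive axis [pochhammer b n] is a product
    of the log-concave factors [b + k], hence log-concave in [b]
    ([pochhammer_midpoint_log_concave]).  The arguments [(mu -+ nu + 3) / 2]
    are affine in [(mu, nu)], so each term of the series, a nonnegative constant over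
    such Pochhammer symbols, is log-convex.  Sums of log-convex functions are
    log-convex; for midpoints this is the Cauchy-Schwarz inequality
    ([Series_Cauchy_Schwarz]). *)

Lemma pochhammer_pos (b : R) (n : nat) : 0 < b -> 0 < pochhammer b n.
Proof.
  intros Hb; induction n as [|n IH]; simpl; [lra|].
  apply Rmult_lt_0_compat; [exact IH|].
  pose proof (pos_INR n); lra.
Qed.

(** Factor by factor, this is the inequality between the arithmetic and the
    geometric mean of [b1 + k] and [b2 + k]. *)
Lemma pochhammer_midpoint_log_concave (b1 b2 : R) (n : nat) :
  0 < b1 -> 0 < b2 ->
  pochhammer b1 n * pochhammer b2 n <= pochhammer ((b1 + b2) / 2) n ^ 2.
Proof.
  intros H1 H2; induction n as [|n IH]; cbn [pochhammer]; [lra|].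
  pose proof (pos_INR n) as Hn.
  pose proof (pochhammer_pos b1 n H1) as P1.
  pose proof (pochhammer_pos b2 n H2) as P2.
  rewrite Rpow_mult_distr.
  replace (pochhammer b1 n * (b1 + INR n) * (pochhammer b2 n * (b2 + INR n)))
    with (pochhammer b1 n * pochhammer b2 n * ((b1 + INR n) * (b2 + INR n)))
    by ring.
  apply Rmult_le_compat; [nra|nra|exact IH|].
  pose proof (pow2_ge_0 (b1 - b2)); nra.
Qed.

(** The hypothesis [r n ^ 2 <= p n * q n] gives
    [2 * s * r n <= s ^ 2 * p n + q n] for every real [s], a relation that is
    linear in the three sequences and so passes to the sums.  The choice
    [s = Series r / Series p], for [Series p > 0], then gives the conclusion
    without square roots. *)
Lemma Series_Cauchy_Schwarz (p q r : nat -> R) :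
  (forall n, 0 <= p n) -> (forall n, 0 <= q n) ->
  (forall n, r n ^ 2 <= p n * q n) ->
  ex_series p -> ex_series q -> ex_series r ->
  Series r ^ 2 <= Series p * Series q.
Proof.
  intros Hp Hq Hr Ep Eq Er.
  assert (Hterm : forall s n, 0 <= s ^ 2 * p n + q n - 2 * s * r n).
  { intros s n. specialize (Hp n); specialize (Hq n); specialize (Hr n).
    assert (Hsum : 0 <= s ^ 2 * p n + q n)
      by (pose proof (pow2_ge_0 s); nra).
    assert (Hsq : (2 * s * r n) ^ 2 <= (s ^ 2 * p n + q n) ^ 2).
    { apply Rle_trans with (4 * s ^ 2 * (p n * q n)).
      - replace ((2 * s * r n) ^ 2) with (4 * s ^ 2 * r n ^ 2) by ring.
        apply Rmult_le_compat_l; [pose proof (pow2_ge_0 s); lra|exact Hr].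
      - pose proof (pow2_ge_0 (s ^ 2 * p n - q n)); nra. }
    enough (2 * s * r n <= s ^ 2 * p n + q n) by lra.
    apply Rsqr_incr_0_var; [rewrite !Rsqr_pow2; exact Hsq|exact Hsum]. }
  assert (Hnonneg : forall u : nat -> R,
            (forall n, 0 <= u n) -> ex_series u -> 0 <= Series u).
  { intros u Hu Eu. replace 0 with (Series (fun _ : nat => 0 * 0)).
    - apply Series_le; [intros n; rewrite Rmult_0_l; split; [lra|apply Hu]|].
      exact Eu.
    - rewrite Series_scal_l; ring. }
  assert (Hs : forall s, 2 * s * Series r <= s ^ 2 * Series p + Series q).
  { intros s.
    assert (E1 : ex_series (fun n => s ^ 2 * p n))
      by (now apply (ex_series_scal_l (s ^ 2) p)).
    assert (E2 : ex_series (fun n => s ^ 2 * p n + q n))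
      by (now apply (ex_series_plus (fun n => s ^ 2 * p n) q)).
    assert (E3 : ex_series (fun n => 2 * s * r n))
      by (now apply (ex_series_scal_l (2 * s) r)).
    assert (E4 : ex_series (fun n => s ^ 2 * p n + q n - 2 * s * r n))
      by (now apply (ex_series_minus (fun n => s ^ 2 * p n + q n)
                                     (fun n => 2 * s * r n))).
    pose proof (Hnonneg _ (Hterm s) E4) as H.
    rewrite Series_minus, Series_plus, !Series_scal_l in H by assumption.
    lra. }
  destruct (Hnonneg p Hp Ep) as [Ppos|P0].
  - specialize (Hs (Series r / Series p)).
    apply Rmult_le_compat_l with (r := Series p) in Hs; [|lra].
    replace (Series p * (2 * (Series r / Series p) * Series r))
      with (2 * Series r ^ 2) in Hs by (field; lra).
    replace (Series p * ((Series r / Series p) ^ 2 * Series p + Series q))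
      with (Series r ^ 2 + Series p * Series q) in Hs by (field; lra).
    lra.
  - (* The relation is now affine in [s], which forces [Series r = 0]. *)
    rewrite <- P0 in *.
    destruct (Req_dec (Series r) 0) as [R0|R0]; [rewrite R0; lra|].
    specialize (Hs ((Series q + 1) / Series r)).
    replace (2 * ((Series q + 1) / Series r) * Series r)
      with (2 * (Series q + 1)) in Hs by (now field).
    pose proof (Hnonneg q Hq Eq); lra.
Qed.

Lemma ex_series_lommel_term_pos (mu nu x : R) :
  0 < mu - nu + 3 -> 0 < mu + nu + 3 -> ex_series (lommel_term mu nu x).
Proof.
  intros H1 H2; apply ex_series_lommel_term;
    intros k; pose proof (pos_INR k); lra.
Qed.

Lemma lommel_term_nonneg (mu nu x : R) (n : nat) :
  0 < mu - nu + 3 -> 0 < mu + nu + 3 -> 0 <= lommel_term mu nu x n.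
Proof.
  intros H1 H2; unfold lommel_term. apply Rdiv_le_0_compat.
  - rewrite pow_mult; apply pow_le, pow2_ge_0.
  - repeat apply Rmult_lt_0_compat; try (apply pochhammer_pos; lra).
    apply pow_lt; lra.
Qed.

Lemma lommel_term_midpoint_log_convex (mu1 nu1 mu2 nu2 x : R) (n : nat) :
  0 < mu1 - nu1 + 3 -> 0 < mu1 + nu1 + 3 ->
  0 < mu2 - nu2 + 3 -> 0 < mu2 + nu2 + 3 ->
  lommel_term ((mu1 + mu2) / 2) ((nu1 + nu2) / 2) x n ^ 2
    <= lommel_term mu1 nu1 x n * lommel_term mu2 nu2 x n.
Proof.
  intros Hb1 Hc1 Hb2 Hc2; unfold lommel_term.
  set (b1 := (mu1 - nu1 + 3) / 2); set (c1 := (mu1 + nu1 + 3) / 2).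
  set (b2 := (mu2 - nu2 + 3) / 2); set (c2 := (mu2 + nu2 + 3) / 2).
  replace (((mu1 + mu2) / 2 - (nu1 + nu2) / 2 + 3) / 2) with ((b1 + b2) / 2)
    by (unfold b1, b2; field).
  replace (((mu1 + mu2) / 2 + (nu1 + nu2) / 2 + 3) / 2) with ((c1 + c2) / 2)
    by (unfold c1, c2; field).
  assert (0 < b1) by (unfold b1; lra). assert (0 < b2) by (unfold b2; lra).
  assert (0 < c1) by (unfold c1; lra). assert (0 < c2) by (unfold c2; lra).
  pose proof (pochhammer_midpoint_log_concave b1 b2 n ltac:(lra) ltac:(lra)) as Hb.
  pose proof (pochhammer_midpoint_log_concave c1 c2 n ltac:(lra) ltac:(lra)) as Hc.
  pose proof (pochhammer_pos b1 n ltac:(lra)).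
  pose proof (pochhammer_pos b2 n ltac:(lra)).
  pose proof (pochhammer_pos c1 n ltac:(lra)).
  pose proof (pochhammer_pos c2 n ltac:(lra)).
  pose proof (pochhammer_pos ((b1 + b2) / 2) n ltac:(lra)).
  pose proof (pochhammer_pos ((c1 + c2) / 2) n ltac:(lra)).
  assert (0 < 4 ^ n) by (apply pow_lt; lra).
  set (B1 := pochhammer b1 n) in *; set (B2 := pochhammer b2 n) in *.
  set (C1 := pochhammer c1 n) in *; set (C2 := pochhammer c2 n) in *.
  set (B := pochhammer ((b1 + b2) / 2) n) in *.
  set (C := pochhammer ((c1 + c2) / 2) n) in *.
  set (y := x ^ (2 * n)); set (z := 4 ^ n) in *.
  replace ((y / (B * C * z)) ^ 2) with ((y / z) ^ 2 * / (B ^ 2 * C ^ 2))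
    by (field; lra).
  replace (y / (B1 * C1 * z) * (y / (B2 * C2 * z)))
    with ((y / z) ^ 2 * / (B1 * B2 * (C1 * C2))) by (field; lra).
  apply Rmult_le_compat_l; [apply pow2_ge_0|].
  assert (0 < B1 * B2) by (now apply Rmult_lt_0_compat).
  assert (0 < C1 * C2) by (now apply Rmult_lt_0_compat).
  apply Rinv_le_contravar; [now apply Rmult_lt_0_compat|].
  apply Rmult_le_compat; lra.
Qed.

Lemma lommel_midpoint_log_convex (mu1 nu1 mu2 nu2 x : R) :
  0 < mu1 - nu1 + 3 -> 0 < mu1 + nu1 + 3 ->
  0 < mu2 - nu2 + 3 -> 0 < mu2 + nu2 + 3 ->
  lommel ((mu1 + mu2) / 2) ((nu1 + nu2) / 2) x ^ 2
    <= lommel mu1 nu1 x * lommel mu2 nu2 x.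
Proof.
  intros Hb1 Hc1 Hb2 Hc2; unfold lommel. apply Series_Cauchy_Schwarz.
  - intros n; now apply lommel_term_nonneg.
  - intros n; now apply lommel_term_nonneg.
  - intros n; now apply lommel_term_midpoint_log_convex.
  - now apply ex_series_lommel_term_pos.
  - now apply ex_series_lommel_term_pos.
  - apply ex_series_lommel_term_pos; lra.
Qed.

Theorem mainTheorem2 (x mu nu a : R) (hx : 0 < x) :
  (mu + a > -1 -> mu - a > -1 ->
   (forall e1 e2 : R, (e1 = 1 \/ e1 = -1) -> (e2 = 1 \/ e2 = -1) ->
      mu + e1 * a + e2 * nu + 3 > 0) ->
   (lommel mu nu x) ^ 2 <= lommel (mu + a) nu x * lommel (mu - a) nu x)
  /\
  (mu > -1 ->
   (forall e1 e2 : R, (e1 = 1 \/ e1 = -1) -> (e2 = 1 \/ e2 = -1) ->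
      mu + e1 * a + e2 * nu + 3 > 0) ->
   (lommel mu nu x) ^ 2 <= lommel mu (nu + a) x * lommel mu (nu - a) x).
Proof.
  assert (Hsigns :
    (forall e1 e2 : R, (e1 = 1 \/ e1 = -1) -> (e2 = 1 \/ e2 = -1) ->
       mu + e1 * a + e2 * nu + 3 > 0) ->
    (0 < mu + a + nu + 3 /\ 0 < mu + a - nu + 3) /\
    (0 < mu - a + nu + 3 /\ 0 < mu - a - nu + 3)).
  { intros H.
    pose proof (H 1 1 ltac:(now left) ltac:(now left)).
    pose proof (H 1 (-1) ltac:(now left) ltac:(now right)).
    pose proof (H (-1) 1 ltac:(now right) ltac:(now left)).
    pose proof (H (-1) (-1) ltac:(now right) ltac:(now right)).
    lra. }
  split.
  - intros _ _ H; apply Hsigns in H.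
    pose proof (lommel_midpoint_log_convex (mu + a) nu (mu - a) nu x
                  ltac:(lra) ltac:(lra) ltac:(lra) ltac:(lra)) as L.
    replace ((mu + a + (mu - a)) / 2) with mu in L by field.
    replace ((nu + nu) / 2) with nu in L by field.
    exact L.
  - intros _ H; apply Hsigns in H.
    pose proof (lommel_midpoint_log_convex mu (nu + a) mu (nu - a) x
                  ltac:(lra) ltac:(lra) ltac:(lra) ltac:(lra)) as L.
    replace ((mu + mu) / 2) with mu in L by field.
    replace ((nu + a + (nu - a)) / 2) with nu in L by field.
    exact L.
Qed.
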